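(* Let $p\ge1$, let $A$ be a $p\times p$ matrix with entries in $[0,1]$, let $\Delta_p=\{x\in\mathbb{R}^p: x\ge0,\ \sum_i x(i)=1\}$, let $v^*=\max_{x\in\Delta_p}x^TAx$, and let $\varepsilon>0$. Then there exists a $\frac{32\ln(3/\varepsilon)}{\varepsilon^3}$-uniform vector $x\in\Delta_p$ such that $v^*-x^TAx<\varepsilon$.
   Context: For a positive integer $k$, a vector $x\in\Delta_p$ is $k$-uniform if every coordinate of $x$ is of the form $\beta_i/k$ with $\beta_i$ a nonnegative integer (equivalently, $x=\sum_i(\beta_i/k)e_i$ with $\sum_i\beta_i=k$, where $e_i$ are the standard basis vectors).
   Formalization: Since k-uniformity is defined only for positive integers k, while 32 ln(3/ε)/ε³ is generally not an integer and is ≤ 0 for ε ≥ 3, it is replaced by the least positive integer that is at least 32 ln(3/ε)/ε³. *)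

(* Defs.v *)
From mathcomp Require Import all_boot all_order all_algebra.
From mathcomp Require Import all_classical all_reals all_analysis.
Set Implicit Arguments.
Unset Strict Implicit.
Unset Printing Implicit Defensive.
Import Order.TTheory GRing.Theory Num.Theory.
Import numFieldNormedType.Exports.
Local Open Scope classical_set_scope.
Local Open Scope ring_scope.

Definition simplex (R : realType) (p : nat) : set 'cV[R]_p :=
  [set x | (forall i, 0 <= x i 0) /\ \sum_i x i 0 = 1].

Definition qform (R : realType) (p : nat) (A : 'M[R]_p) (x : 'cV[R]_p) : R :=
  (x^T *m A *m x) 0 0.

Definition is_max (R : realType) (S : set R) (m : R) : Prop :=
  S m /\ ubound S m.

(* Meant for 0 < k; for k = 0 no vector qualifies, as b%:R / 0 = 0. *)
Definition uniform (R : realType) (p k : nat) (x : 'cV[R]_p) : Prop :=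
  simplex x /\ forall i, exists b : nat, x i 0 = b%:R / k%:R.

(* The bound 32 ln (3 / eps) / eps ^ 3 is rarely an integer, and it is
   nonpositive when eps >= 3: it is read as the least positive integer that
   is at least this real number. *)
Definition granularity (R : realType) (eps : R) : nat :=
  absz (Num.max 1 (Num.ceil (32 * ln (3 / eps) / eps ^+ 3))).

Lemma granularity_gt0 (R : realType) (eps : R) : (0 < granularity eps)%N.
Proof.
rewrite /granularity absz_gt0.
by apply: lt0r_neq0; rewrite lt_max ltr01.
Qed.

Lemma granularity_ge (R : realType) (eps : R) :
  32 * ln (3 / eps) / eps ^+ 3 <= (granularity eps)%:R.
Proof.
rewrite /granularity natr_absz ger0_norm; last by rewrite le_max ler01.
by apply: le_trans (ceil_ge _) _; rewrite ler_int le_max lexx orbT.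
Qed.

Lemma granularity_min (R : realType) (eps : R) (k : nat) : (0 < k)%N ->
  32 * ln (3 / eps) / eps ^+ 3 <= k%:R -> (granularity eps <= k)%N.
Proof.
move=> k0 hk; rewrite -lez_nat gez0_abs; last by rewrite le_max ler01.
by rewrite ge_max ceil_le_int lez_nat k0.
Qed.

Lemma is_max_qform (R : realType) (p : nat) (A : 'M[R]_p) : (0 < p)%N ->
  exists v, is_max (qform A @` @simplex R p) v.
Proof.
move=> p0.
have csum (F : 'I_p -> 'rV[R]_p -> R) :
  (forall i, continuous (F i)) -> continuous (fun y => \sum_i F i y).
  move=> cF; have -> : (fun y => \sum_i F i y) = \sum_i F i.
    by apply/funext => y; rewrite fct_sumE.
  apply: (big_ind (fun f : 'rV[R]_p -> R => continuous f)) =>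
    [|f g cf cg|i _]; last exact: cF.
    exact: (@cst_continuous _ _ (0 : R)).
  by move=> y; exact: (continuousD (cf y) (cg y)).
have ccoord i : continuous (fun y : 'rV[R]_p => y 0 i).
  exact: coord_continuous.
pose S : set 'rV[R]_p := [set y | simplex y^T].
have SE : S = [set y : 'rV[R]_p | \sum_i y 0 i = 1] `&`
              \bigcap_i [set y : 'rV[R]_p | 0 <= y 0 i].
  apply/seteqP; split => [y [h1 h2]|y [h1 h2]].
    split; first by rewrite /= -h2; apply: eq_bigr => i _; rewrite mxE.
    by move=> i _; have := h1 i; rewrite mxE.
  split; first by move=> i; rewrite mxE; exact: h2.
  by rewrite -h1; apply: eq_bigr => i _; rewrite mxE.
have Scompact : compact S.
  apply: bounded_closed_compact; last first.
    rewrite SE; apply: closedI.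
      apply: (@preimage_closed _ _ (fun y : 'rV[R]_p => \sum_i y 0 i) [set 1]).
        by move=> y _; exact: csum.
      exact: closed_eq.
    apply: closed_bigI => i _.
    apply: (@preimage_closed _ _ (fun y : 'rV[R]_p => y 0 i) [set x | 0 <= x]).
      by move=> y _; exact: ccoord.
    exact: closed_ge.
  exists 1; split=> // M M1 y [h1 h2]; apply: le_trans (ltW M1).
  rewrite [leLHS]mx_normrE; apply: bigmax_le => // -[i j] _ /=.
  rewrite (ord1 i); have := h1 j; rewrite mxE => yj.
  rewrite ger0_norm // -h2 (bigD1 j) //= mxE lerDl.
  by apply: sumr_ge0 => k _; exact: h1.
have S0 : S !=set0.
  exists (delta_mx 0 (Ordinal p0)); split=> [i|].
    by rewrite !mxE /= ler0n.
  rewrite (bigD1 (Ordinal p0)) //= !mxE !eqxx big1 ?addr0 // => i ni.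
  by rewrite !mxE (negbTE ni) andbF.
have qc : continuous (fun y : 'rV[R]_p => qform A y^T).
  have -> : (fun y : 'rV[R]_p => qform A y^T) =
            (fun y => \sum_j (\sum_i y 0 i * A i j) * y 0 j).
    apply/funext => y; rewrite /qform trmxK mxE; apply: eq_bigr => j _.
    by rewrite !mxE.
  apply: (csum) => j y; apply: continuousM; last exact: ccoord.
  apply: (csum) => i z; apply: continuousM; first exact: ccoord.
  exact: cst_continuous.
have [c cS cmax] := EVT_max_rV S0 Scompact (continuous_subspaceT qc).
exists (qform A c^T); split.
  by exists c^T => //; rewrite inE in cS.
move=> _ [x xS <-]; have := cmax x^T; rewrite !trmxK; apply.
by rewrite inE /S /= trmxK.
Qed.

(* Main.v *)
Require Import Defs.
From mathcomp Require Import all_boot all_order all_algebra.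
From mathcomp Require Import all_classical all_reals all_analysis.
From mathcomp Require Import ring lra.
Import Order.TTheory GRing.Theory Num.Theory.
Local Open Scope classical_set_scope.
Local Open Scope ring_scope.

(** Let [x] maximise the form and let [c] count the outcomes of [k] independent
    draws from the distribution [x]. The [k * (k - 1)] ordered pairs of distinct
    draws contribute [vstar] each to the expectation of [qform A c], and the
    diagonal pairs contribute a nonnegative amount, so some outcome has
    [qform A (c / k) >= (1 - 1 / k) * vstar]. As [vstar <= 1], the loss is at
    most [1 / k], which is below [eps] for the granularity [k] of the theorem.
    The outcome is found by conditional expectations, one draw at a time. *)

Section BilinearForm.
Context {R : realType} {p : nat}.
Implicit Types (A : 'M[R]_p) (u v w x y : 'cV[R]_p).

(** The polarisation of [qform]: its diagonal [bform A x x] is convertible to [qform A x], and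
    linearity in each argument lets one draw be split off. *)
Definition bform A u w : R := (u^T *m A *m w) 0 0.

Lemma bformDl A u v w : bform A (u + v) w = bform A u w + bform A v w.
Proof. by rewrite /bform linearD /= !mulmxDl mxE. Qed.

Lemma bformDr A u v w : bform A u (v + w) = bform A u v + bform A u w.
Proof. by rewrite /bform mulmxDr mxE. Qed.

Lemma bformZl A a u w : bform A (a *: u) w = a * bform A u w.
Proof. by rewrite /bform linearZ /= -!scalemxAl mxE. Qed.

Lemma bformZr A a u w : bform A u (a *: w) = a * bform A u w.
Proof. by rewrite /bform -scalemxAr mxE. Qed.

Lemma bform0l A w : bform A 0 w = 0.
Proof. by rewrite /bform trmx0 !mul0mx mxE. Qed.

Lemma bform0r A u : bform A u 0 = 0.
Proof. by rewrite /bform mulmx0 mxE. Qed.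

Lemma bform_suml A x w :
  bform A x w = \sum_i x i 0 * bform A (delta_mx i 0) w.
Proof.
rewrite /bform -mulmxA mxE; apply: eq_bigr => i _.
by rewrite trmx_delta -mulmxA -rowE !mxE.
Qed.

Lemma bform_sumr A u x :
  bform A u x = \sum_i x i 0 * bform A u (delta_mx i 0).
Proof.
rewrite {1}/bform mxE; apply: eq_bigr => i _.
by rewrite /bform -colE [in RHS]mxE mulrC.
Qed.

Lemma bform_delta A i j : bform A (delta_mx i 0) (delta_mx j 0) = A i j.
Proof. by rewrite /bform trmx_delta -rowE -colE !mxE. Qed.

(** Otherwise every [m - g j] is positive while their [x]-average is zero, which forces [x = 0]
    against total mass 1. *)
Lemma simplex_avg_le x (g : 'I_p -> R) : simplex x ->
  exists i, \sum_j x j 0 * g j <= g i.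
Proof.
move=> [x0 x1]; set m := \sum_j _.
apply/not_existsP => gm.
have gm' i : g i < m by rewrite ltNge; apply/negP; exact: gm.
have s0 : \sum_j x j 0 * (m - g j) = 0.
  under eq_bigr do rewrite mulrBr.
  by rewrite sumrB -mulr_suml x1 mul1r subrr.
have t0 j : 0 <= x j 0 * (m - g j).
  by rewrite mulr_ge0// subr_ge0 ltW.
have xz j : x j 0 = 0.
  move/eqP: s0; rewrite psumr_eq0// => /allP/(_ j (mem_index_enum _))/=.
  by rewrite mulf_eq0 subr_eq0 (gt_eqF (gm' j)) orbF => /eqP.
by move: x1; rewrite big1// => /esym/eqP; rewrite oner_eq0.
Qed.

Lemma simplex_avg_le_cst x (g : 'I_p -> R) c : simplex x ->
  (forall i, g i <= c) -> \sum_i x i 0 * g i <= c.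
Proof.
by move=> hx gc; have [i] := simplex_avg_le x g hx => /le_trans; exact.
Qed.

(* The lower bound is the expected value of the form at [y] plus [k] independent
   draws from [x], less the nonnegative diagonal term [k * \sum_i x i 0 * A i i]. *)
Lemma conditional_expectation_draws A x : simplex x ->
    (forall i, 0 <= A i i) -> forall (k : nat) y,
  exists c : 'I_p -> nat, (\sum_i c i)%N = k /\
    bform A y y + k%:R * (bform A y x + bform A x y)
      + k%:R * (k%:R - 1) * bform A x x
    <= bform A (y + \col_i (c i)%:R) (y + \col_i (c i)%:R).
Proof.
move=> hx A0; elim=> [|k IH] y.
  exists (fun=> 0%N); split; first by rewrite big1.
  have -> : (\col_i 0%:R : 'cV[R]_p) = 0 by apply/matrixP => i j; rewrite !mxE.
  by rewrite addr0 !mul0r !addr0.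
pose e i : 'cV[R]_p := delta_mx i 0.
(* The induction hypothesis bound once the next draw has come out as [i]; some [i] does at least as
   well as the [x]-average. *)
pose g i := bform A (y + e i) (y + e i)
  + k%:R * (bform A (y + e i) x + bform A x (y + e i))
  + k%:R * (k%:R - 1) * bform A x x.
have [i hi] := simplex_avg_le x g hx.
have [c [ck hc]] := IH (y + e i).
exists (fun j => (j == i) + c j)%N; split.
  by rewrite big_split /= ck (bigD1 i) //= eqxx big1 ?addn0 // => j /negbTE ->.
have -> : y + \col_j ((j == i) + c j)%:R = y + e i + \col_j (c j)%:R :> 'cV[R]_p.
  by rewrite -addrA; congr (_ + _); apply/colP => j; rewrite !mxE natrD andbT.
apply: le_trans hc; apply: le_trans hi.
have gE j : x j 0 * g j =
    x j 0 * (bform A y y + k%:R * (bform A y x + bform A x y)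
             + k%:R * (k%:R - 1) * bform A x x)
    + (x j 0 * bform A y (e j) + x j 0 * bform A (e j) y)
    + k%:R * (x j 0 * bform A (e j) x + x j 0 * bform A x (e j))
    + x j 0 * A j j.
  rewrite /g !(bformDl, bformDr) bform_delta; ring.
under eq_bigr do rewrite gE.
rewrite !big_split /= -mulr_suml -mulr_sumr big_split /=.
rewrite -!bform_sumr -!bform_suml (proj2 hx).
(* In the average, [bform A x x] has coefficient [k * (k - 1) + 2 * k = (k + 1) * k], as required
   for [k.+1] draws; only this diagonal sum is left over. *)
have : 0 <= \sum_j x j 0 * A j j.
  by apply: sumr_ge0 => j _; rewrite mulr_ge0 //; exact: (proj1 hx).
rewrite -[k.+1]addn1 natrD; set s := \sum_j _; lra.
Qed.

(** Drawing from [y = 0] leaves only the term [k * (k - 1) * bform A x x]; scaling the counts by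
    [1 / k] divides it by [k ^ 2]. *)
Lemma qform_uniform_approx A x (k : nat) : (0 < k)%N -> simplex x ->
    (forall i, 0 <= A i i) ->
  exists z : 'cV[R]_p, uniform k z /\
    qform A x - qform A z <= qform A x / k%:R.
Proof.
move=> k0 hx A0.
have kR : k%:R != 0 :> R by rewrite pnatr_eq0 -lt0n.
have kp : 0 < k%:R :> R by rewrite ltr0n.
have [c [ck]] := conditional_expectation_draws A x hx A0 k 0.
rewrite !bform0l bform0r !add0r mulr0 add0r; set d := (\col_i _) => hc.
exists (k%:R^-1 *: d); split.
  split; last by move=> i; exists (c i); rewrite !mxE mulrC.
  split; first by move=> i; rewrite !mxE mulr_ge0 ?invr_ge0 ?ler0n.
  under eq_bigr do rewrite !mxE.
  by rewrite -mulr_sumr -natr_sum ck mulVf.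
rewrite /qform -!/(bform _ _ _) bformZl bformZr.
have -> : bform A x x / k%:R =
    bform A x x - k%:R^-1 * (k%:R^-1 * (k%:R * (k%:R - 1) * bform A x x)).
  by field.
by rewrite lerD2l lerN2 !ler_pM2l ?invr_gt0.
Qed.

Lemma qform_le1 A x : simplex x -> (forall i j, A i j <= 1) -> qform A x <= 1.
Proof.
move=> hx A1; rewrite /qform -/(bform A x x) bform_suml.
apply: simplex_avg_le_cst => // i; rewrite bform_sumr.
by apply: simplex_avg_le_cst => // j; rewrite bform_delta.
Qed.

End BilinearForm.

(** For [eps > 1], a granularity of at least 1 suffices. For [eps <= 1], the product is at least
    [32 * ln (3 / eps) >= 64 / 3], as multiplying it by [eps ^ 2] cannot increase it. *)
Lemma granularity_eps_gt1 (R : realType) (eps : R) : 0 < eps ->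
  1 < (granularity eps)%:R * eps.
Proof.
move=> e0; have k1 : 1 <= (granularity eps)%:R :> R.
  by rewrite ler1n granularity_gt0.
have [e1|e1] := ltP 1 eps.
  by rewrite (lt_le_trans e1)// ler_peMl// ltW.
have e2 : eps ^+ 2 <= 1 by rewrite expr_le1// ltW.
(* From [ln t <= t - 1] at [t = eps / 3], negated: [ln (3 / eps) >= 1 - eps / 3]. *)
have l3 : 2 / 3 <= ln (3 / eps).
  have : ln (1 + (eps / 3 - 1)) <= eps / 3 - 1 by apply: le_ln1Dx; lra.
  rewrite [1 + _]addrC subrK.
  rewrite -[X in ln X]invf_div lnV ?posrE ?divr_gt0 //; lra.
have : 32 * ln (3 / eps) <= (granularity eps)%:R * eps * eps ^+ 2.
  by rewrite -mulrA -exprS -ler_pdivrMr ?exprn_gt0 // granularity_ge.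
have : (granularity eps)%:R * eps * eps ^+ 2 <= (granularity eps)%:R * eps.
  by rewrite ler_piMr // mulr_ge0 // ltW.
lra.
Qed.

Theorem theorem7 (R : realType) (p : nat) (A : 'M[R]_p) (vstar eps : R)
    (hp : (1 <= p)%N)
    (hA : forall i j, 0 <= A i j <= 1)
    (hv : is_max [set qform A x | x in @simplex R p] vstar)
    (heps : 0 < eps) :
  exists x : 'cV[R]_p,
    uniform (granularity eps) x /\ vstar - qform A x < eps.
Proof.
have [[x hx <-] _] := hv.
have A0 i : 0 <= A i i by case/andP: (hA i i).
have A1 i j : A i j <= 1 by case/andP: (hA i j).
have k0 := granularity_gt0 eps.
have [z [uz hz]] := qform_uniform_approx A x _ k0 hx A0.
exists z; split=> //; apply: le_lt_trans hz _.
rewrite ltr_pdivrMr ?ltr0n // mulrC.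
exact: le_lt_trans (qform_le1 A x hx A1) (granularity_eps_gt1 _ _ heps).
Qed.
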